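(* Let $(X_t,V_t)$ be the Tempered Bouncy Particle Sampler described in the context, with bounce counting process $N^b$. Let $\tau:=\inf\{t\ge0:|X_t|+|V_t|+N^b_t=\infty\}$. Then $\mathbb{P}(\tau<\infty)=0$.
   Context: Let $d\ge1$ and let $U:\mathbb{R}^d\to\mathbb{R}$ be smooth with $Z_U:=\int e^{-U(x)}dx\in(0,\infty)$. Let $\sigma:\mathbb{R}^d\to[1,\infty)$ be smooth and Lipschitz, and $\kappa_x:=N(0,\sigma^2(x)I_d)$. Let $\nabla_xH(x,v):=\nabla U(x)+\frac{1}{\sigma(x)}\bigl[d-\frac{|v|^2}{\sigma^2(x)}\bigr]\nabla\sigma(x)$; $R_ub:=b-2|u|^{-2}\langle b,u\rangle u$ for $u\neq0$ and $R_0b:=b$; $a_+:=\max\{0,a\}$. Tempered Bouncy Particle Sampler: the piecewise deterministic Markov process $(X_t,V_t)$ on $\mathbb{R}^d\times\mathbb{R}^d$, a priori defined up to its explosion time, with $X_t=X_0+\int_0^tV_s\,ds$ and $V_t=V_0+\int_0^t(R_{\nabla_xH(X_s,V_{s-})}V_{s-}-V_{s-})\,dN^b_s+\int_0^t(\tilde V_s-V_{s-})\,dN^r_s$, where $N^r$ is a Poisson process of constant intensity $\lambda_r>0$; at each jump time $s$ of $N^r$, $\tilde V_s$ is sampled from $\kappa_{X_s}$ independently of the path on $[0,s)$; $N^b$ is a counting process started from $0$ with unit jumps and stochastic intensity $\langle V_t,\nabla_xH(X_t,V_t)\rangle_+$. *)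

(* Defs.v *)
From HB Require Import structures.
From mathcomp Require Import all_boot all_order all_algebra.
From mathcomp Require Import all_classical all_reals all_analysis.
Set Implicit Arguments. Unset Strict Implicit. Unset Printing Implicit Defensive.
Import Order.TTheory GRing.Theory Num.Theory.
Import numFieldNormedType.Exports.
Local Open Scope classical_set_scope.
Local Open Scope ring_scope.

(* Lebesgue measure on R^n, realised on [n.-tuple R], whose library
   sigma-algebra is generated by the coordinate projections: the n-fold product
   of [lebesgue_measure]. *)
Definition cons_tuple (R : realType) (n : nat)
    (p : measurableTypeR R * n.-tuple (measurableTypeR R)) :
    n.+1.-tuple (measurableTypeR R) := [tuple of p.1 :: p.2].

Lemma measurable_cons_tuple (R : realType) (n : nat) :
  measurable_fun setT (@cons_tuple R n).
Proof. exact: measurable_cons. Qed.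

HB.instance Definition _ (R : realType) (n : nat) :=
  isMeasurableFun.Build _ _ _ _ (@cons_tuple R n) (@measurable_cons_tuple R n).

Definition lebesgue_cons (R : realType) (n : nat)
    (m : {sigma_finite_measure set (n.-tuple (measurableTypeR R)) -> \bar R}) :=
  pushforward (lebesgue_measure \x m)%E (@cons_tuple R n).

Section lebesgue_cons.
Context (R : realType) (n : nat)
  (m : {sigma_finite_measure set (n.-tuple (measurableTypeR R)) -> \bar R}).

Let lebesgue_cons0 : lebesgue_cons m set0 = 0%E.
Proof. exact: measure0. Qed.

Let lebesgue_cons_ge0 A : (0 <= lebesgue_cons m A)%E.
Proof. exact: measure_ge0. Qed.

Let lebesgue_cons_sigma_additive : semi_sigma_additive (lebesgue_cons m).
Proof. exact: measure_semi_sigma_additive. Qed.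

HB.instance Definition _ := isMeasure.Build _ _ _ (lebesgue_cons m)
  lebesgue_cons0 lebesgue_cons_ge0 lebesgue_cons_sigma_additive.

Let lebesgue_cons_sigma_finite : sigma_finite setT (lebesgue_cons m).
Proof.
have /sigma_finiteP[F [TF ndF Foo]] := sigma_finiteT (@lebesgue_measure R).
have /sigma_finiteP[G [TG ndG Goo]] := sigma_finiteT m.
pose g (t : n.+1.-tuple (measurableTypeR R)) :
    measurableTypeR R * n.-tuple (measurableTypeR R) :=
  (thead t, [tuple of behead t]).
have mg : measurable_fun setT g.
  apply: measurable_fun_pair; last exact: measurable_behead.
  exact: measurable_tnth.
exists (fun k => g @^-1` (F k `*` G k)).
  apply/esym; rewrite -subTset => t _.
  have : [set: measurableTypeR R] (thead t) by [].
  have : [set: n.-tuple (measurableTypeR R)] [tuple of behead t] by [].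
  rewrite TF TG => -[k _ Gk] [l _ Fl]; exists (maxn l k) => //; split.
    by move: Fl; exact/subsetPset/ndF/leq_maxl.
  by move: Gk; exact/subsetPset/ndG/leq_maxr.
move=> k; have [mF Fk] := Foo k; have [mG Gk] := Goo k; split.
  by rewrite -[X in measurable X]setTI; apply: mg => //; exact: measurableX.
rewrite /lebesgue_cons /pushforward (_ : _ @^-1` _ = F k `*` G k).
  by rewrite product_measure1E// lte_mul_pinfty// ge0_fin_numE.
rewrite -comp_preimage (_ : g \o _ = id)//; apply/funext => -[x t].
by rewrite /g /cons_tuple/=; congr (_, _); exact: val_inj.
Qed.

HB.instance Definition _ := Measure_isSigmaFinite.Build _ _ _ (lebesgue_cons m)
  lebesgue_cons_sigma_finite.

End lebesgue_cons.

Fixpoint lebesgue_tuple (R : realType) (n : nat) :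
    {sigma_finite_measure set (n.-tuple (measurableTypeR R)) -> \bar R} :=
  match n with
  | 0 => dirac [tuple]
  | n.+1 => lebesgue_cons (lebesgue_tuple R n)
  end.

Definition rV_of_tuple (R : realType) (d : nat) (t : d.-tuple R) : 'rV[R]_d :=
  \row_i tnth t i.

Section euclidean_space.
Context {R : realType} {d : nat}.
Implicit Types (u v b x y : 'rV[R]_d) (f : 'rV[R]_d -> R).

(* The library norm on ['rV_d] is the max norm; [enorm] is the Euclidean one.
   Both induce the same topology and the same derivatives. *)
Definition dotp u v : R := \sum_i u 0 i * v 0 i.

Definition enorm u : R := Num.sqrt (dotp u u).

Definition grad f x : 'rV[R]_d := \row_i 'D_(delta_mx 0 i) f x.

Fixpoint class_C (k : nat) f : Prop :=
  continuous f /\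
  if k is k'.+1 then
    forall i : 'I_d, (forall x, derivable f x (delta_mx 0 i)) /\
                     class_C k' (fun x => 'D_(delta_mx 0 i) f x)
  else True.

Definition smooth f : Prop := forall k, class_C k f.

Definition lipschitz_fun f : Prop :=
  exists L : R, forall x y, `|f x - f y| <= L * enorm (x - y).

Definition borel : set (set 'rV[R]_d) := <<s [set O | open O] >>.

Definition partition_function f : \bar R :=
  (\int[lebesgue_tuple R d]_t (expR (- f (rV_of_tuple t)))%:E)%E.

(* N(0, s^2 I_d) for s > 0. *)
Definition gaussian_law (s : R) (B : set 'rV[R]_d) : \bar R :=
  (\int[lebesgue_tuple R d]_(t in @rV_of_tuple R d @^-1` B)
    (\prod_(i < d) normal_pdf 0 s (tnth t i))%:E)%E.

Definition bounce u b : 'rV[R]_d :=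
  if u == 0 then b else b - (2 / enorm u ^+ 2 * dotp b u) *: u.

Definition gradH (U sigma : 'rV[R]_d -> R) x v : 'rV[R]_d :=
  grad U x +
  ((sigma x)^-1 * (d%:R - enorm v ^+ 2 / sigma x ^+ 2)) *: grad sigma x.

Definition bounce_rate (U sigma : 'rV[R]_d -> R) x v : R :=
  Num.max 0 (dotp v (gradH U sigma x v)).

End euclidean_space.

Section point_processes.
Context {R : realType} {dO : measure_display} {Omega : measurableType dO}.
Implicit Types (F : R -> set (set Omega)) (T : nat -> Omega -> \bar R).

(* Time is [0, +oo[; the values of families indexed by R at negative times are
   irrelevant throughout. *)
Record filtration F : Prop := Filtration {
  filtration_sigma : forall t : R, 0 <= t -> sigma_algebra setT (F t) ;
  filtration_sub : forall t : R, 0 <= t -> F t `<=` measurable ;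
  filtration_mono : forall s t : R, 0 <= s -> s <= t -> F s `<=` F t }.

(* A counting process started from 0 with unit jumps, possibly explosive, is
   given by its successive jump times [T 0 < T 1 < ...] in ]0, +oo], where
   [T n = +oo] means that there are at most n jumps. *)
Record point_process F T : Prop := PointProcess {
  point_process_gt0 : forall w, (0 < T 0%N w)%E ;
  point_process_lt : forall n w, (T n w < +oo)%E -> (T n w < T n.+1 w)%E ;
  point_process_pinfty : forall n w, T n w = +oo%E -> T n.+1 w = +oo%E ;
  point_process_adapted : forall n (t : R), 0 <= t ->
    F t [set w | (T n w <= t%:E)%E] }.

Definition counting_at T (t : R) (w : Omega) : \bar R :=
  (\sum_(0 <= n <oo) ((T n w <= t%:E)%E)%:R%:E)%E.

Record poisson_process (P : probability Omega R) F (lam : R) T : Prop :=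
  PoissonProcess {
  poisson_point_process : point_process F T ;
  poisson_increments : forall (s t : R) (A : set Omega) (k : nat),
    0 <= s -> s < t -> F s A ->
    (P (A `&` [set w | counting_at T t w - counting_at T s w = k%:R%:E]) =
     P A * (poisson_pmf (lam * (t - s)) k)%:E)%E }.

Definition predictable_sigma F : set (set (R * Omega)) :=
  <<s [set B | (exists A, F 0 A /\ B = [set 0] `*` A) \/
               (exists (s t : R) A, [/\ 0 <= s, s <= t, F s A &
                                  B = `]s, t]%classic `*` A])] >>.

Definition predictable F (C : R -> Omega -> R) : Prop :=
  forall B : set R, <<s [set O | open O] >> B ->
    predictable_sigma F [set p | B (C p.1 p.2)].

(* [lam] is the stochastic F-intensity, on [0, zeta[, of the point process with
   jump times [T]: E int_[0,zeta[ C dN = E int_[0,zeta[ C_s lam_s ds for every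
   nonnegative F-predictable C. *)
Definition stochastic_intensity (P : probability Omega R) F
    (zeta : Omega -> \bar R) T (lam : R -> Omega -> R) : Prop :=
  forall C : R -> Omega -> R, predictable F C -> (forall s w, 0 <= C s w) ->
  (\int[P]_w (\sum_(0 <= n <oo)
      (if T n w < zeta w then (C (fine (T n w)) w)%:E else 0)) =
   \int[P]_w \int[lebesgue_measure]_(s in [set s : R | (0 <= s)%R /\ s%:E < zeta w])
      (C s w * lam s w)%:E)%E.

(* The sigma-algebra of events strictly before the random time [S]. *)
Definition strict_past F (S : Omega -> \bar R) : set (set Omega) :=
  <<s [set B | F 0 B \/ exists (t : R) A, [/\ 0 <= t, F t A &
                          B = A `&` [set w | (t%:E < S w)%E]]] >>.

End point_processes.

Section tempered_bps.
Context {R : realType} {d : nat} {dO : measure_display}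
  {Omega : measurableType dO}.

(* Positions and velocities live in R^d with a point at infinity, [None]. *)
Implicit Types (X V : R -> Omega -> option 'rV[R]_d)
  (Tb Tr : nat -> Omega -> \bar R) (Vr : nat -> Omega -> 'rV[R]_d).

Definition ext_norm (x : option 'rV[R]_d) : \bar R :=
  if x is Some x' then (enorm x')%:E else +oo%E.

Definition fin_part (X : R -> Omega -> option 'rV[R]_d) (t : R) (w : Omega) :
  'rV[R]_d := odflt 0 (X t w).

Definition left_lim V (s : R) (w : Omega) : 'rV[R]_d :=
  lim (fin_part V u w @[u --> s^'-]).

Definition adapted (F : R -> set (set Omega)) X : Prop :=
  forall (t : R) (B : set 'rV[R]_d), 0 <= t -> borel B ->
    F t [set w | exists2 x, B x & X t w = Some x].

Definition total_size X V Tb (t : R) (w : Omega) : \bar R :=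
  (ext_norm (X t w) + ext_norm (V t w) + counting_at Tb t w)%E.

Definition explosion_time X V Tb (w : Omega) : \bar R :=
  ereal_inf [set t%:E | t in [set t : R | 0 <= t /\
                                total_size X V Tb t w = +oo%E]].

(* [Tb] and [Tr] are the jump times of N^b and N^r, and [Vr n] is the velocity
   sampled at time [Tr n].  The dynamics are prescribed on [0, tau[ only;
   [tbps_explosion] says that the process is not stopped before it actually
   explodes (in particular tau > 0, so X_0 and V_0 are finite). *)
Record tempered_bps (U sigma : 'rV[R]_d -> R) (lam_r : R)
    (P : probability Omega R) (F : R -> set (set Omega))
    X V Tb Tr Vr : Prop := TemperedBPS {
  tbps_filtration : filtration F ;
  tbps_adaptedX : adapted F X ;
  tbps_adaptedV : adapted F V ;
  tbps_explosion : {ae P, forall w,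
    (explosion_time X V Tb w < +oo)%E ->
    ereal_sup [set total_size X V Tb t w | t in
      [set t : R | 0 <= t /\ (t%:E < explosion_time X V Tb w)%E]] = +oo%E} ;
  tbps_position : {ae P, forall w, forall t : R, 0 <= t ->
    (t%:E < explosion_time X V Tb w)%E ->
    fin_part X t w = fin_part X 0 w +
      \row_i (\int[lebesgue_measure]_(s in `[0, t]) fin_part V s w 0 i)} ;
  tbps_velocity : {ae P, forall w, forall t : R, 0 <= t ->
    (t%:E < explosion_time X V Tb w)%E ->
    fin_part V t w = fin_part V 0 w
      + \sum_(n \in [set n | (Tb n w <= t%:E)%E])
          (let s := fine (Tb n w) in let v := left_lim V s w in
           bounce (gradH U sigma (fin_part X s w) v) v - v)
      + \sum_(n \in [set n | (Tr n w <= t%:E)%E])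
          (Vr n w - left_lim V (fine (Tr n w)) w)} ;
  tbps_refresh_times : poisson_process P F lam_r Tr ;
  tbps_refresh_measurable : forall n B, borel B -> measurable (Vr n @^-1` B) ;
  tbps_refresh_law : forall n A B, strict_past F (Tr n) A -> borel B ->
    (\int[P]_(w in A `&` [set w | Tr n w < explosion_time X V Tb w])
       (\1_B (Vr n w))%:E =
     \int[P]_(w in A `&` [set w | Tr n w < explosion_time X V Tb w])
       gaussian_law (sigma (fin_part X (fine (Tr n w)) w)) B)%E ;
  tbps_bounce_times : point_process F Tb ;
  tbps_bounce_intensity :
    stochastic_intensity P F (explosion_time X V Tb) Tb
      (fun t w => bounce_rate U sigma (fin_part X t w) (fin_part V t w)) }.

End tempered_bps.

(* Main.v *)
(* A bounce preserves the speed, and a refreshment replaces the velocity by a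
   finite one. Almost surely there are finitely many refreshments in bounded
   time, so on [{tau < oo}] the velocity, hence also the position, stays bounded
   on [[0, tau[]: explosion can only be an accumulation of bounces at [tau]. As
   long as the initial position and the velocity at rational times are bounded
   by [m], up to time [m], the bounce rate is bounded, so the compensator
   formula for this predictable localisation bounds the expected number of
   bounces, and bounces almost surely do not accumulate.

   [explosion_time] is not known to be measurable, so the two integrals in the
   compensator formula are only lower integrals; almost every path, on the other
   hand, has all bounces before [tau] as soon as they accumulate, which puts a
   measurable event below the integrand. *)
Require Import Defs.
From HB Require Import structures.
From mathcomp Require Import all_boot all_order all_algebra.
From mathcomp Require Import all_classical all_reals all_analysis.
From mathcomp Require Import measurable_realfun ring lra zify.
Set Implicit Arguments. Unset Strict Implicit. Unset Printing Implicit Defensive.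
Import Order.TTheory GRing.Theory Num.Theory.
Import numFieldNormedType.Exports.
Local Open Scope classical_set_scope.
Local Open Scope ring_scope.

(** * Bounces as isometries; Euclidean norm against max norm *)

Section dotp.
Context {R : realType} {d : nat}.
Implicit Types u v b : 'rV[R]_d.

Lemma dotp_ge0 v : 0 <= dotp v v.
Proof. by apply: sumr_ge0 => i _; rewrite -expr2 sqr_ge0. Qed.

Lemma sqr_enorm v : enorm v ^+ 2 = dotp v v.
Proof. by rewrite sqr_sqrtr ?dotp_ge0. Qed.

Lemma dotp_eq0 v : (dotp v v == 0) = (v == 0).
Proof.
apply/idP/eqP => [|->]; last first.
  by rewrite /dotp big1// => i _; rewrite mxE mul0r.
rewrite psumr_eq0 => [/allP h|i _]; last by rewrite -expr2 sqr_ge0.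
apply/rowP => i; rewrite mxE; apply/eqP.
by have := h i (mem_index_enum _); rewrite /= -expr2 sqrf_eq0.
Qed.

(** For nonzero [u] the bounce is a reflection: with c = 2<b,u>/|u|^2, the terms -2c<b,u> and
    c^2|u|^2 of the expanded square cancel. *)
Lemma dotp_bounce u b : dotp (bounce u b) (bounce u b) = dotp b b.
Proof.
rewrite /bounce; case: eqP => // /eqP u0.
have q0 : dotp u u != 0 by rewrite dotp_eq0.
have expand c : dotp (b - c *: u) (b - c *: u) =
    dotp b b - c * dotp b u *+ 2 + c ^+ 2 * dotp u u.
  rewrite /dotp -mulrnAr -sumrMnl !mulr_sumr -sumrN -!big_split/=.
  by apply: eq_bigr => i _; rewrite !mxE; ring.
by rewrite expand sqr_enorm; field.
Qed.

(** In each coordinate, 3(a^2 + b^2 + c^2) - (a + b + c)^2 is the sum of the squares of the pairwise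
    differences. *)
Lemma dotp_addD_le (x y z : 'rV[R]_d) :
  dotp (x + y + z) (x + y + z) <= 3 * (dotp x x + dotp y y + dotp z z).
Proof.
rewrite /dotp -!big_split/= mulr_sumr; apply: ler_sum => i _; rewrite !mxE.
move: (x 0 i) (y 0 i) (z 0 i) => a b c.
by have := (sqr_ge0 (a - b), sqr_ge0 (b - c), sqr_ge0 (a - c)) => -[[]]; nra.
Qed.

Lemma coord_le_norm v i : `|v 0 i| <= `|v|.
Proof.
rewrite [leRHS]/Num.Def.normr/= mx_normrE; apply/bigmax_geP; right => /=.
by exists (0, i).
Qed.

Lemma norm_le_coord v (K : R) :
  0 <= K -> (forall i, `|v 0 i| <= K) -> `|v| <= K.
Proof.
move=> K0 h; rewrite [leLHS]/Num.Def.normr/= mx_normrE.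
rewrite bigmax_le// => -[i j] _ /=; by rewrite (ord1 i).
Qed.

Lemma norm_le_dotp v : `|v| <= 1 + dotp v v.
Proof.
apply: norm_le_coord => [|i]; first by rewrite addr_ge0// dotp_ge0.
have : `|v 0 i| ^+ 2 <= dotp v v.
  rewrite real_normK ?num_real// /dotp (bigD1 i)//= expr2 lerDl.
  by apply: sumr_ge0 => j _; rewrite -expr2 sqr_ge0.
have := sqr_ge0 (`|v 0 i| - 1); nra.
Qed.

Lemma dotp_le_norm v K : `|v| <= K -> dotp v v <= d%:R * K ^+ 2.
Proof.
move=> vK; rewrite -[d in d%:R]card_ord mulr_natl -sumr_const.
apply: ler_sum => j _; rewrite -expr2 -real_normK ?num_real// lerXn2r ?nnegrE//.
  exact: le_trans vK.
exact: le_trans (coord_le_norm _ _) vK.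
Qed.

Lemma enorm_le_norm v K : `|v| <= K -> enorm v <= 1 + d%:R * K ^+ 2.
Proof.
move=> /dotp_le_norm; rewrite -sqr_enorm => vK.
suff : enorm v <= 1 + enorm v ^+ 2 by move/le_trans; apply; rewrite lerD2l.
have := (sqr_ge0 (enorm v), sqr_ge0 (enorm v - 1)) => -[].
by rewrite sqrrB1; lra.
Qed.

End dotp.

(** * Jump times along a fixed outcome *)

Section counting.
Context {R : realType}.
Implicit Types T : nat -> \bar R.

(** The pathwise part of [point_process], so that path arguments are deterministic. *)
Definition jump_times T : Prop :=
  [/\ (0 < T 0%N)%E, forall n, (T n < +oo)%E -> (T n < T n.+1)%E &
      forall n, T n = +oo%E -> T n.+1 = +oo%E].

Lemma jump_times_nondecreasing T m n :
  jump_times T -> (m <= n)%N -> (T m <= T n)%E.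
Proof.
move=> [_ Tlt Too] /subnK <-; elim: (n - m)%N => // k /le_trans; apply.
rewrite addSn; have [/Too ->|] := eqVneq (T (k + m)%N) +oo%E; first exact: leey.
by rewrite -ltey => /Tlt /ltW.
Qed.

Lemma jump_times_gt0 T n : jump_times T -> (0 < T n)%E.
Proof.
move=> jT; have [T0 _ _] := jT.
exact: lt_le_trans T0 (jump_times_nondecreasing jT _).
Qed.

Lemma jump_times_fineK T n : jump_times T -> (T n < +oo)%E ->
  T n = (fine (T n))%:E.
Proof.
by move=> jT Too; rewrite fineK// ge0_fin_numE// ltW// jump_times_gt0.
Qed.

Lemma initial_segment (p : pred nat) :
  {homo p : m n / (m <= n)%N >-> n ==> m} ->
  (exists n, ~~ p n) -> exists k, forall n, p n = (n < k)%N.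
Proof.
move=> ph ex; case: (ex_minnP ex) => k pk kmin; exists k => n.
have [nk|kn] := ltnP n k.
  by apply/negPn/negP => /kmin; rewrite leqNgt nk.
by apply/negbTE; apply: contra pk; apply/implyP/ph.
Qed.

Lemma count_le T (t : R) : jump_times T -> (exists n, (t%:E < T n)%E) ->
  exists k, forall n, (T n <= t%:E)%E = (n < k)%N.
Proof.
move=> jT [n tn]; apply: (@initial_segment (fun n => T n <= t%:E)%E).
  by move=> i j ij; apply/implyP => /=; apply: le_trans;
    exact: jump_times_nondecreasing.
by exists n; rewrite -ltNge.
Qed.

Lemma count_lt T (t : R) : jump_times T -> (exists n, (t%:E < T n)%E) ->
  exists k, forall n, (T n < t%:E)%E = (n < k)%N.
Proof.
move=> jT [n tn]; apply: (@initial_segment (fun n => T n < t%:E)%E).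
  by move=> i j ij; apply/implyP => /=; apply: le_lt_trans;
    exact: jump_times_nondecreasing.
by exists n; rewrite -leNgt ltW.
Qed.

(** [u0] is the last jump time before [s], or 0 if there is none; on []u0, s[] the count is frozen
    at its left limit in [s]. *)
Lemma count_left T (s : R) k : jump_times T -> 0 < s ->
  (forall n, (T n < s%:E)%E = (n < k)%N) ->
  exists u0, [/\ 0 <= u0, u0 < s &
    forall u, u0 < u < s -> forall n, (T n <= u%:E)%E = (n < k)%N].
Proof.
move=> jT s0 Tk; case: k Tk => [|k] Tk.
  exists 0; split=> // u /andP[_ us] n.
  rewrite ltn0; apply/negbTE; rewrite -ltNge.
  by apply: (@lt_le_trans _ _ s%:E); rewrite ?lte_fin// leNgt Tk.
have Tks : (T k < s%:E)%E by rewrite Tk.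
have Tk0 := jump_times_gt0 k jT.
have Tkf := jump_times_fineK jT (lt_trans Tks (ltry s)).
exists (fine (T k)); split.
- by rewrite fine_ge0// ltW.
- by rewrite -lte_fin -Tkf.
move=> u /andP[ku us] n; have [nk|nk] := ltnP n k.+1.
  apply: le_trans (@jump_times_nondecreasing _ n k jT nk) _.
  by rewrite Tkf lee_fin ltW.
apply/negbTE; rewrite -ltNge; apply: (@lt_le_trans _ _ s%:E).
  by rewrite lte_fin.
by rewrite leNgt Tk ltnNge nk.
Qed.

Lemma fsum_count (Z : zmodType) T (t : R) k (f : nat -> Z) :
  (forall n, (T n <= t%:E)%E = (n < k)%N) ->
  \sum_(n \in [set n | (T n <= t%:E)%E]) f n = \sum_(n < k) f n.
Proof.
move=> Tk; rewrite fsbig_ord; apply: eq_fsbigl; apply/seteqP.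
by split=> n /=; rewrite Tk.
Qed.

(** Finite jump times are strictly increasing, so at most one of them equals [s]. *)
Lemma strict_count_step T (s : R) k k' : jump_times T ->
  (forall n, (T n <= s%:E)%E = (n < k)%N) ->
  (forall n, (T n < s%:E)%E = (n < k')%N) ->
  k = k' \/ (k = k'.+1 /\ T k' = s%:E).
Proof.
move=> jT Tk Tk'; have [_ Tlt _] := jT.
have k'k : (k' <= k)%N.
  by case: k' Tk' => // k' Tk'; rewrite -Tk ltW// Tk'.
move: k'k; rewrite leq_eqVlt => /orP[/eqP->|k'k]; [by left|right].
have Tk's : T k' = s%:E.
  by apply/le_anti; rewrite Tk k'k leNgt Tk' ltnn.
split=> //; apply/eqP; rewrite eqn_leq k'k andbT leqNgt -Tk -ltNge -Tk's Tlt//.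
by rewrite Tk's ltry.
Qed.

End counting.

(** * Speed bound for a deterministic path driven by bounces and refreshments *)

Section velocity_path.
Context {R : realType} {d : nat}.
Variables (v : R -> 'rV[R]_d) (tau : \bar R) (tb tr : nat -> \bar R)
  (g : R -> 'rV[R]_d -> 'rV[R]_d) (z : nat -> 'rV[R]_d).
Let ll (s : R) : 'rV[R]_d := lim (v u @[u --> s^'-]).
Let jb n := let s := fine (tb n) in let l := ll s in bounce (g s l) l - l.
Let jr n := z n - ll (fine (tr n)).
Hypothesis jump_tb : jump_times tb.
Hypothesis jump_tr : jump_times tr.
Hypothesis velocity : forall t : R, 0 <= t -> (t%:E < tau)%E ->
  v t = v 0 + \sum_(n \in [set n | (tb n <= t%:E)%E]) jb n
            + \sum_(n \in [set n | (tr n <= t%:E)%E]) jr n.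
Hypothesis tb_locfin : forall t : R, 0 <= t -> (t%:E < tau)%E ->
  exists n, (t%:E < tb n)%E.
Hypothesis tr_locfin : forall t : R, 0 <= t -> exists n, (t%:E < tr n)%E.

(** By the velocity equation, the path depends on time only through the two jump counts. *)
Let W k l := v 0 + \sum_(n < k) jb n + \sum_(n < l) jr n.

Let velocity_count (t : R) k l : 0 <= t -> (t%:E < tau)%E ->
  (forall n, (tb n <= t%:E)%E = (n < k)%N) ->
  (forall n, (tr n <= t%:E)%E = (n < l)%N) -> v t = W k l.
Proof.
move=> t0 ttau kb lr; apply: etrans (velocity t0 ttau) _.
by congr (_ + _ + _); exact: fsum_count.
Qed.

(** Neither clock accumulates at [s], so both are idle on some []u0, s[]. The path is constant
    there, which makes [ll s] a genuine limit rather than a default value of [lim]. *)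
Lemma velocity_left_constant (s : R) : 0 < s -> (s%:E < tau)%E ->
  exists k l u0,
  [/\ 0 <= u0 < s, forall n, (tb n < s%:E)%E = (n < k)%N,
      forall n, (tr n < s%:E)%E = (n < l)%N, ll s = W k l &
      forall u, u0 < u < s -> [/\ v u = W k l,
        forall n, (tb n <= u%:E)%E = (n < k)%N &
        forall n, (tr n <= u%:E)%E = (n < l)%N]].
Proof.
move=> s0 stau.
have [k kb] := count_lt jump_tb (tb_locfin (ltW s0) stau).
have [l lr] := count_lt jump_tr (tr_locfin (ltW s0)).
have [u1 [u10 u1s u1k]] := count_left jump_tb s0 kb.
have [u2 [u20 u2s u2l]] := count_left jump_tr s0 lr.
have m0 : 0 <= Num.max u1 u2 by rewrite le_max u10.
have near_s u : Num.max u1 u2 < u < s -> [/\ v u = W k l,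
        forall n, (tb n <= u%:E)%E = (n < k)%N &
        forall n, (tr n <= u%:E)%E = (n < l)%N].
  rewrite gt_max => /andP[/andP[u1u u2u] us].
  have kb' : forall n, (tb n <= u%:E)%E = (n < k)%N by apply: u1k; rewrite u1u.
  have lr' : forall n, (tr n <= u%:E)%E = (n < l)%N by apply: u2l; rewrite u2u.
  split=> //; apply: velocity_count => //; first by rewrite (le_trans u10)// ltW.
  by rewrite (lt_trans _ stau)// lte_fin.
exists k, l, (Num.max u1 u2); split=> //.
  by rewrite m0 gt_max u1s u2s.
apply: lim_near_cst => //; near=> u.
suff /near_s[] : Num.max u1 u2 < u < s by [].
by apply/andP; split; near: u; [apply: nbhs_left_gt; rewrite gt_max u1s|
  exact: nbhs_left_lt].
Unshelve. all: by end_near. Qed.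

(** This lets the velocity at [s] be read at an earlier rational time. *)
Lemma velocity_nonjump (s : R) : 0 < s -> (s%:E < tau)%E ->
  (forall n, tb n != s%:E) -> (forall n, tr n != s%:E) ->
  exists2 u0, 0 <= u0 < s & forall u, u0 < u < s -> v s = v u.
Proof.
move=> s0 stau nb nr.
have [k [l [u0 [u0s kb lr _ vu]]]] := velocity_left_constant s0 stau.
exists u0 => // u /vu[-> _ _]; apply: velocity_count => //; first exact: ltW.
  by move=> n; rewrite le_eqVlt (negbTE (nb n)) kb.
by move=> n; rewrite le_eqVlt (negbTE (nr n)) lr.
Qed.

(** Indexed by the number of refreshments alone: bounces cost nothing, and their number is not yet
    controlled up to [tau]. *)
Fixpoint speed_bound n : R :=
  if n is n.+1 then 6 * speed_bound n + 3 * dotp (z n) (z n)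
  else dotp (v 0) (v 0).

Let speed_bound_ge0 n : 0 <= speed_bound n.
Proof.
elim: n => [|n ih] /=; first exact: dotp_ge0.
by rewrite addr_ge0 ?mulr_ge0// dotp_ge0.
Qed.

Let speed_bound_nondecreasing m n :
  (m <= n)%N -> speed_bound m <= speed_bound n.
Proof.
move=> /subnK <-; elim: (n - m)%N => // k /le_trans; apply; rewrite addSn /=.
by have := speed_bound_ge0 (k + m); have := dotp_ge0 (z (k + m)%N); lra.
Qed.

(* A bounce preserves the speed and a refreshment replaces the velocity; the
   factors 6 and 3 only absorb simultaneous jumps of the two clocks. *)
Let speed_jump (s : R) k l k' l' : 0 < s -> (s%:E < tau)%E ->
  (forall n, (tb n <= s%:E)%E = (n < k)%N) ->
  (forall n, (tr n <= s%:E)%E = (n < l)%N) ->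
  (forall n, (tb n < s%:E)%E = (n < k')%N) ->
  (forall n, (tr n < s%:E)%E = (n < l')%N) -> ll s = W k' l' ->
  dotp (W k' l') (W k' l') <= speed_bound l' ->
  dotp (v s) (v s) <= speed_bound l.
Proof.
move=> s0 stau kb lr kb' lr' lls ih.
have -> := velocity_count (ltW s0) stau kb lr.
have Wb i j : W i.+1 j = W i j + jb i.
  by rewrite /W big_ord_recr [RHS]addrAC; congr (_ + _); exact: addrA.
have Wr i j : W i j.+1 = W i j + jr j.
  by rewrite /W big_ord_recr; exact: addrA.
have jbE i : tb i = s%:E -> jb i = bounce (g s (W k' l')) (W k' l') - W k' l'.
  by move=> tbi; rewrite -lls /jb tbi.
have jrE i : tr i = s%:E -> jr i = z i - W k' l'.
  by move=> tri; rewrite -lls /jr tri.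
have [->|[-> tbs]] := strict_count_step jump_tb kb kb';
  have [->|[-> trs]] := strict_count_step jump_tr lr lr' => //;
  rewrite ?Wr ?Wb ?(jbE _ tbs) ?(jrE _ trs);
  move: (W k' l') ih => w ih; have w0 := dotp_ge0 w.
- rewrite addrC subrK /=.
  by have := speed_bound_ge0 l'; have := dotp_ge0 (z l'); lra.
- by rewrite addrC subrK dotp_bounce.
(* Both clocks jump at [s]: both increments start from the same left limit [w], so the new velocity
   is the bounced [w], plus [z l'], minus [w]. *)
- rewrite [w + _]addrC subrK addrA.
  apply: le_trans (dotp_addD_le _ _ _) _; rewrite dotp_bounce.
  have -> : dotp (- w) (- w) = dotp w w.
    by apply: eq_bigr => i _; rewrite !mxE mulrNN.
  by rewrite /=; lra.
Qed.

(** Induction on the total number of jumps up to [t]. The velocity has not changed since the last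
    jump, and just before that jump the total count is smaller. *)
Let velocity_bounded_count m : forall (t : R) k l, 0 <= t -> (t%:E < tau)%E ->
  (forall n, (tb n <= t%:E)%E = (n < k)%N) ->
  (forall n, (tr n <= t%:E)%E = (n < l)%N) -> (k + l < m)%N ->
  dotp (v t) (v t) <= speed_bound l.
Proof.
elim: m => // m ih t k l t0 ttau kb lr; rewrite ltnS => klm.
have [kl0|kl0] := eqVneq (k + l)%N 0%N.
  have [k0 l0] : k = 0%N /\ l = 0%N by lia.
  have -> := velocity_count t0 ttau kb lr.
  rewrite k0 l0; suff -> : W 0 0 = v 0 by [].
  by rewrite /W !big_ord0; apply: etrans (addr0 _) (addr0 _).
(* [s] is the later of the last bounce and the last refreshment up to [t]. *)
have [s [s0 st kb' lr' sj]] : exists s : R, [/\ 0 < s, s <= t,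
    forall n, (tb n <= s%:E)%E = (n < k)%N,
    forall n, (tr n <= s%:E)%E = (n < l)%N &
    (exists n, tb n = s%:E) \/ exists n, tr n = s%:E].
  have last T j : jump_times T -> (forall n, (T n <= t%:E)%E = (n < j.+1)%N) ->
      exists s : R, [/\ 0 < s, s <= t, T j = s%:E &
        forall s', s <= s' -> s' <= t ->
          forall n, (T n <= s'%:E)%E = (n < j.+1)%N].
    move=> jT Tj; have Tj0 := jump_times_gt0 j jT.
    have Tjt : (T j <= t%:E)%E by rewrite Tj.
    have Tjf := jump_times_fineK jT (le_lt_trans Tjt (ltry t)).
    exists (fine (T j)); split=> //.
    - by rewrite -lte_fin -Tjf.
    - by rewrite -lee_fin -Tjf.
    move=> s' sjs' s't n; have [nj|nj] := ltnP n j.+1.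
      apply: le_trans (@jump_times_nondecreasing _ _ n j jT nj) _.
      by rewrite Tjf lee_fin.
    apply: contraTF nj => Tns'; rewrite -ltnNge -Tj.
    by rewrite (le_trans Tns')// lee_fin.
  have empty T (s : R) : (forall n, (T n <= t%:E)%E = (n < 0)%N) -> s <= t ->
      forall n, (T n <= s%:E)%E = (n < 0)%N.
    move=> T0 st n; rewrite ltn0; apply/negbTE; have := T0 n; rewrite ltn0.
    by move/negbT; apply: contra => /le_trans; apply; rewrite lee_fin.
  case: k l kb lr klm kl0 => [|k] [|l] kb lr klm kl0 //.
  - have [s [s0 st Ts sl]] := last _ _ jump_tr lr.
    by exists s; split=> //; [exact: empty|exact: sl|right; exists l].
  - have [s [s0 st Ts sl]] := last _ _ jump_tb kb.
    by exists s; split=> //; [exact: sl|exact: empty|left; exists k].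
  - have [s [s0 st Ts sl]] := last _ _ jump_tr lr.
    have [s' [s'0 s't Ts' sl']] := last _ _ jump_tb kb.
    have [ss'|/ltW s's] := leP s s'.
      by exists s'; split=> //; [exact: sl'|exact: sl|left; exists k].
    by exists s; split=> //; [exact: sl'|exact: sl|right; exists l].
have stau : (s%:E < tau)%E by apply: le_lt_trans ttau; rewrite lee_fin.
have -> : v t = v s.
  rewrite (velocity_count t0 ttau kb lr).
  by rewrite (velocity_count (ltW s0) stau kb' lr').
have [k' [l' [u0 [/andP[u00 u0s] kb'' lr'' lls vu]]]] :=
  velocity_left_constant s0 stau.
apply: (speed_jump s0 stau kb' lr' kb'' lr'' lls).
(* At the midpoint the velocity already equals the left limit at [s], so the induction hypothesis
   applies there. *)
have [] := vu ((u0 + s) / 2); first by rewrite !midf_lt.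
move=> <- kbu lru; apply: (ih _ k' l') => //.
- by rewrite divr_ge0// addr_ge0// ltW.
- by apply: lt_trans stau; rewrite lte_fin midf_lt.
- have := strict_count_step jump_tb kb' kb''.
  have := strict_count_step jump_tr lr' lr''.
  move=> [le|[le _]] [ke|[ke _]]; try by lia.
  exfalso; case: sj => -[n ns].
    by have := kb' n; rewrite ke -kb'' ns lexx ltxx.
  by have := lr' n; rewrite le -lr'' ns lexx ltxx.
Qed.

(** The refreshments up to [t1] dominate those up to any earlier time, and [speed_bound] is monotone
    in their number. *)
Lemma velocity_bounded (t1 : R) : 0 <= t1 -> exists2 B, 0 <= B &
  forall t, 0 <= t <= t1 -> (t%:E < tau)%E -> `|v t| <= B.
Proof.
move=> t10; have [l1 l1r] := count_le jump_tr (tr_locfin t10).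
exists (1 + speed_bound l1) => [|t /andP[t0 tt1] ttau].
  by rewrite addr_ge0.
have [k kb] := count_le jump_tb (tb_locfin t0 ttau).
have [l lr] := count_le jump_tr (tr_locfin t0).
apply: le_trans (norm_le_dotp _) _; rewrite lerD2l.
apply: le_trans (velocity_bounded_count t0 ttau kb lr (ltnSn _)) _.
apply: speed_bound_nondecreasing; case: l lr => // l lr.
by rewrite -l1r (@le_trans _ _ t%:E) ?lee_fin// lr.
Qed.

End velocity_path.

(** * Comparison of integrals without measurability of the smaller function *)

Section lower_integral.
Context {dT : measure_display} {T : measurableType dT} {R : realType}
  (mu : {measure set T -> \bar R}).
Local Open Scope ereal_scope.

(* The integral of a nonnegative function is a supremum over the simple
   functions below it, so it is monotone even for non-measurable functions. *)
Lemma ge0_subset_le_integral (D E : set T) (f g : T -> \bar R) :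
  (forall x, D x -> 0 <= f x) -> (forall x, E x -> 0 <= g x) ->
  (forall x, (f \_ D) x <= (g \_ E) x) ->
  \int[mu]_(x in D) f x <= \int[mu]_(x in E) g x.
Proof.
move=> f0 g0 fg; rewrite ge0_integralE// ge0_integralE//.
apply: ge_ereal_sup => _ [h /= hf <-]; apply: ereal_sup_ubound.
exists h => //= x.
exact: le_trans (hf x) (fg x).
Qed.

(** Raising [g] to [+oo] on the null set [N] keeps its integral and makes it dominate [f] everywhere
    on [D]. *)
Lemma ge0_integral_le_off_null (D N : set T) (f g : T -> \bar R) :
  measurable N -> mu N = 0 -> (forall x, D x -> 0 <= f x) ->
  measurable_fun [set: T] g -> (forall x, 0 <= g x) ->
  (forall x, D x -> ~ N x -> f x <= g x) ->
  \int[mu]_(x in D) f x <= \int[mu]_x g x.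
Proof.
move=> mN N0 f0 mg g0 fg.
pose g' x := if x \in N then +oo else g x.
have mg' : measurable_fun setT g'.
  apply: measurable_fun_ifT => //.
  apply: (measurable_fun_bool true); rewrite setTI (_ : _ @^-1` _ = N)//.
    by apply/seteqP; split=> x /= => [/set_mem|/mem_set].
have g'0 x : 0 <= g' x by rewrite /g'; case: ifP.
have -> : \int[mu]_x g x = \int[mu]_x g' x.
  apply: ge0_ae_eq_integral => //; exists N; split=> // x /= h.
  apply: contrapT => Nx; apply: h => _; rewrite /g' ifF//.
  by apply/negbTE/negP => /set_mem.
apply: ge0_subset_le_integral => // x; rewrite !patchE in_setT /=.
case: ifPn => [/set_mem Dx|_ //]; rewrite /g'.
case: ifPn => [_|]; first exact: leey.
by move=> /negP xN; apply: fg => // Nx; apply: xN; exact/mem_set.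
Qed.

End lower_integral.

(** * Time integrals bounded off countably many instants *)

Section time_integral.
Context {R : realType}.
Implicit Types (t K : R) (J : set R).

Lemma ge0_integral_le_off_countable (D J : set R) (f : R -> \bar R) t K :
  countable J -> 0 <= t -> 0 <= K -> (forall s, D s -> (0 <= f s)%E) ->
  (forall s, D s -> ~ J s -> (f s <= (if s \in `[0, t] then K else 0)%:E)%E) ->
  (\int[lebesgue_measure]_(s in D) f s <= (K * t)%:E)%E.
Proof.
move=> cJ t0 K0 f0 fK; pose g (s : R) : \bar R := (cst K%:E \_ `[0, t]) s.
have mg : measurable_fun [set: measurableTypeR R] g.
  by apply/(measurable_restrictT (cst K%:E)) => //; exact: measurable_cst.
apply: (@le_trans _ _ (\int[lebesgue_measure]_s g s)%E).
  apply: (@ge0_integral_le_off_null _ (measurableTypeR R) R _ D J) => //.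
  - exact: countable_measurable.
  - exact: countable_lebesgue_measure0.
  - by move=> s; rewrite /g patchE; case: ifP; rewrite ?lee_fin.
  - move=> s Ds Js; apply: le_trans (fK _ Ds Js) _.
    by rewrite /g patchE mem_setE; case: ifP.
rewrite /g -integral_mkcond integral_cst//= lebesgue_measure_itv/= lte_fin.
case: ltP => [_|t0']; first by rewrite oppr0 addr0 EFinM.
by rewrite mule0 lee_fin mulr_ge0.
Qed.

(** The integrals of the positive and negative parts both lie in [0, K t], hence so does the
    absolute value of their difference. Unlike a bound through the integral of |f|, this suits paths
    not known to be measurable in time. *)
Lemma Rintegral_le_off_countable (f : R -> R) J t K :
  countable J -> 0 <= t -> 0 <= K ->
  (forall s, 0 <= s <= t -> ~ J s -> `|f s| <= K) ->
  `|\int[lebesgue_measure]_(s in `[0, t]) f s| <= K * t.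
Proof.
move=> cJ t0 K0 fK; rewrite /Rintegral integralE.
set a := (X in (X - _)%E); set b := (X in (_ - X)%E).
have Kt0 : 0 <= K * t by rewrite mulr_ge0.
have a0 : (0 <= a)%E by apply: integral_ge0.
have b0 : (0 <= b)%E by apply: integral_ge0.
have aK : (a <= (K * t)%:E)%E.
  apply: (ge0_integral_le_off_countable cJ) => // s /= st Js.
  rewrite st funeposE /= -EFin_max lee_fin ge_max K0 andbT.
  apply: le_trans (ler_norm _) _; exact: fK.
have bK : (b <= (K * t)%:E)%E.
  apply: (ge0_integral_le_off_countable cJ) => // s /= st Js.
  rewrite st funenegE /= -EFin_max lee_fin ge_max K0 andbT.
  apply: le_trans (ler_norm _) _; rewrite normrN; exact: fK.
clearbody a b; move: a b a0 b0 aK bK => [a||] [b||]//=.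
by rewrite !lee_fin ler_norml => *; apply/andP; split; lra.
Qed.

End time_integral.

(** * Local boundedness of the bounce rate *)

Section rate_bound.
Context {R : realType} {d : nat}.
Implicit Types (U sigma f : 'rV[R]_d -> R).

Lemma continuous_bounded_norm f (K : R) : continuous f ->
  exists2 M, 0 <= M & forall x, `|x| <= K -> `|f x| <= M.
Proof.
move=> cf.
have cK : compact [set x : 'rV[R]_d | `|x| <= K].
  apply: bounded_closed_compact.
    exists K; split; first exact: num_real.
    by move=> M KM x /= /le_trans; apply; exact: ltW.
  apply: (@closed_comp _ _ (fun x : 'rV[R]_d => `|x|) [set y | y <= K]).
    by move=> x _; exact: norm_continuous.
  exact: closed_le.
have : bounded_set (f @` [set x : 'rV[R]_d | `|x| <= K]).
  apply: compact_bounded; apply: continuous_compact => //.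
  exact: continuous_subspaceT.
move=> [M [_ hM]]; exists (`|M| + 1); first by rewrite addr_ge0.
move=> x xK; apply: hM; first by rewrite ltr_pwDr// ler_norm.
by exists x.
Qed.

Lemma smooth_grad_bounded f (K : R) : smooth f ->
  exists2 M, 0 <= M & forall x, `|x| <= K -> forall i, `|grad f x 0 i| <= M.
Proof.
move=> /(_ 1%N)[_ sf].
have /choice[m hm] : forall i : 'I_d, exists M, 0 <= M /\
    forall x, `|x| <= K -> `|'D_(delta_mx 0 i) f x| <= M.
  move=> i; have [_ [cD _]] := sf i.
  by have [M] := continuous_bounded_norm K cD; exists M.
(* The sum of the nonnegative bounds [m i] serves all coordinates at once. *)
exists (\sum_i m i); first by apply: sumr_ge0 => i _; exact: (hm i).1.
move=> x xK i; rewrite mxE; apply: le_trans ((hm i).2 x xK) _.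
by rewrite (bigD1 i)//= lerDl sumr_ge0// => j _; exact: (hm j).1.
Qed.

Lemma bounce_rate_bounded U sigma (K : R) : smooth U -> smooth sigma ->
  (forall x, 1 <= sigma x) -> 0 <= K ->
  exists2 M, 0 <= M & forall x v, `|x| <= K -> `|v| <= K ->
    bounce_rate U sigma x v <= M.
Proof.
move=> sU ssigma sigma1 K0.
have [A A0 hA] := smooth_grad_bounded K sU.
have [B B0 hB] := smooth_grad_bounded K ssigma.
(* [c] bounds |d - |v|^2 / sigma^2|, since sigma >= 1 and a max norm at most [K] gives |v|^2 <= d
   K^2. *)
pose c := d%:R + d%:R * K ^+ 2 : R.
have c0 : 0 <= c by rewrite /c addr_ge0// mulr_ge0// sqr_ge0.
exists (\sum_(i < d) K * (A + c * B)).
  by apply: sumr_ge0 => i _; rewrite mulr_ge0// addr_ge0// mulr_ge0.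
move=> x v xK vK; rewrite /bounce_rate ge_max; apply/andP; split.
  by apply: sumr_ge0 => i _; rewrite mulr_ge0// addr_ge0// mulr_ge0.
apply: ler_sum => i _; apply: le_trans (ler_norm _) _; rewrite normrM.
apply: ler_pM => //; first exact: le_trans (coord_le_norm _ _) vK.
rewrite /gradH mxE [X in _ + X]mxE; apply: le_trans (ler_normD _ _) _.
apply: lerD; first exact: hA.
rewrite normrM; apply: ler_pM => //; last exact: hB.
have s0 : 0 < sigma x by rewrite (lt_le_trans _ (sigma1 x)).
rewrite normrM normfV (gtr0_norm s0) -[c]mul1r; apply: ler_pM => //.
- by rewrite invr_ge0 ltW.
- by rewrite invf_le1.
apply: le_trans (ler_normB _ _) _; rewrite ger0_norm//; apply: lerD => //.
rewrite sqr_enorm normrM normfV !ger0_norm ?sqr_ge0 ?dotp_ge0//.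
apply: le_trans (dotp_le_norm vK); rewrite ler_piMr ?dotp_ge0//.
by rewrite invf_le1 ?exprn_gt0// exprn_ege1.
Qed.

End rate_bound.

(** * Counting processes; the Poisson clock does not accumulate *)

Section counting_process.
Context {R : realType} {dO : measure_display} {Omega : measurableType dO}.
Implicit Types (F : R -> set (set Omega)) (T : nat -> Omega -> \bar R).

Lemma nneseries_ge1_pinfty (f : nat -> \bar R) : (forall n, (1 <= f n)%E) ->
  (\sum_(0 <= n <oo) f n = +oo)%E.
Proof.
move=> f1; have f0 n : (0 <= f n)%E by apply: le_trans (f1 n); rewrite lee_fin.
apply/eqyP => A A0.
apply: le_trans (nneseries_lim_ge (Num.truncn A).+1 _) => //.
apply: (@le_trans _ _ (\sum_(0 <= i < (Num.truncn A).+1) 1)%E).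
  by rewrite sumEFin sumr_const_nat subn0 lee_fin ltW// truncnS_gt.
exact: lee_sum.
Qed.

Lemma point_process_jump_times F T w : point_process F T -> jump_times (T ^~ w).
Proof.
move=> pT; split.
- exact: point_process_gt0 pT w.
- by move=> n; exact: point_process_lt pT n w.
- by move=> n; exact: point_process_pinfty pT n w.
Qed.

Lemma counting_at_ge0 T t w : (0 <= counting_at T t w)%E.
Proof. by apply: nneseries_ge0 => n _ _; rewrite lee_fin. Qed.

Lemma counting_at_pinfty T (t : R) w :
  (forall n, (T n w <= t%:E)%E) -> counting_at T t w = +oo%E.
Proof. by move=> Tt; apply: nneseries_ge1_pinfty => n; rewrite Tt. Qed.

Lemma counting_at_le T (t : R) w k : jump_times (T ^~ w) ->
  (t%:E < T k w)%E -> (counting_at T t w <= k%:R%:E)%E.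
Proof.
move=> jT tk; rewrite /counting_at (nneseries_split _ k); last first.
  by move=> n _; rewrite lee_fin.
rewrite [X in (_ + X)%E]eseries0 ?adde0.
  apply: (@le_trans _ _ (\sum_(0 <= i < 0 + k) 1)%E).
    by apply: lee_sum => n _; rewrite lee_fin lern1 leq_b1.
  by rewrite sumEFin sumr_const_nat subn0 add0n.
move=> n; rewrite add0n => kn _; rewrite leNgt (lt_le_trans tk)//.
exact: (jump_times_nondecreasing jT kn).
Qed.

Lemma counting_at0 T w : jump_times (T ^~ w) -> counting_at T 0 w = 0%E.
Proof.
by move=> jT; apply: eseries0 => n _ _; rewrite leNgt (jump_times_gt0 n jT).
Qed.

Lemma poisson_pmf_sum1 (r : R) : 0 < r ->
  (\sum_(k <oo) (poisson_pmf r k)%:E = 1)%E.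
Proof.
move=> r0; rewrite nneseries_esumT; last first.
  by move=> n; rewrite lee_fin poisson_pmf_ge0.
have := @probability_setT _ _ _ (poisson_prob r 0).
by rewrite /= /poisson_prob r0.
Qed.

(** The Poisson weights sum to 1, so the count at each positive integer time is almost surely
    finite; countably many such times cover all [t]. *)
Lemma poisson_process_locally_finite (P : probability Omega R) F (lam : R) T :
  filtration F -> 0 < lam -> poisson_process P F lam T ->
  {ae P, forall w, forall t : R, 0 <= t -> exists n, (t%:E < T n w)%E}.
Proof.
move=> hF lam0 [pT incr].
have mle n (m : R) : 0 <= m -> measurable [set w | (T n w <= m%:E)%E].
  move=> m0; apply: (filtration_sub hF m0).
  exact: point_process_adapted pT n m m0.
have neg m : P.-negligible [set w | forall n, (T n w <= m.+1%:R%:E)%E].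
  have m0 : (0 : R) < m.+1%:R by rewrite ltr0n.
  (* Written as an increment from time 0, the form in which [poisson_increments] gives its law; the
     count at 0 vanishes. *)
  pose A k := [set w |
    (counting_at T m.+1%:R w - counting_at T 0 w = k%:R%:E)%E].
  have AE k : A k = [set w | counting_at T m.+1%:R w = k%:R%:E].
    apply/seteqP; split=> w; rewrite /A /=;
      by rewrite (counting_at0 (point_process_jump_times w pT)) sube0.
  have PA k : (P (A k) = (poisson_pmf (lam * m.+1%:R) k)%:E)%E.
    have F0T : F 0 setT.
      have [F00 FC _] := filtration_sigma hF (lexx 0).
      by rewrite -[setT]setD0; exact: FC.
    have := incr 0 m.+1%:R setT k (lexx 0) m0 F0T.
    by rewrite setTI probability_setT mul1e subr0.
  have mA k : measurable (A k).
    rewrite AE; have mN : measurable_fun [set: Omega] (counting_at T m.+1%:R).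
      rewrite /counting_at.
      apply: (ge0_emeasurable_sum (P := xpredT)) => [k' w _ _|k' _].
        by rewrite lee_fin.
      apply/measurable_EFinP.
      have -> : (fun w => (T k' w <= m.+1%:R%:E)%E%:R) =
          \1_[set w | (T k' w <= m.+1%:R%:E)%E] :> (Omega -> R).
        by apply/funext => w; rewrite indicE mem_setE.
      by apply: measurable_indic; exact/mle/ltW.
    have := mN measurableT [set k%:R%:E]; rewrite setTI; apply.
    exact: emeasurable_set1.
  have tA : trivIset setT A.
    apply/trivIsetP => i j _ _ ij; apply/seteqP; split=> w //=.
    rewrite !AE /= => -[-> /eqP]; rewrite eqe eqr_nat => /eqP ij'.
    by move: ij; rewrite ij' eqxx.
  have mUA : measurable (\bigcup_k A k) by exact: bigcup_measurable.
  have PUA : P (\bigcup_k A k) = 1%E.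
    transitivity (\sum_(k <oo) P (A k))%E.
      by rewrite measure_bigcup//; apply: eq_eseriesl => k; rewrite in_setT.
    rewrite -(@poisson_pmf_sum1 (lam * m.+1%:R)) ?mulr_gt0//.
    by apply: eq_eseriesr => k _; exact: PA.
  exists (~` \bigcup_k A k); split; first exact: measurableC.
    by rewrite probability_setC// PUA subee.
  move=> w /= Tm [k _]; rewrite AE /= (counting_at_pinfty Tm) => /eqP.
  by [].
apply: (negligibleS _ (negligible_bigcup neg)) => w /= /existsNP[t].
move=> /not_implyP[t0 /forallNP tT]; exists (Num.truncn t) => // n /=.
apply: (@le_trans _ _ t%:E); first by rewrite leNgt; exact/negP.
by rewrite lee_fin ltW// truncnS_gt.
Qed.

End counting_process.

Section jump_instants.
Context {R : realType} {dO : measure_display} {Omega : measurableType dO}.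
Implicit Types T : nat -> Omega -> \bar R.

(** The instant 0 is included because it has no past to look back to. Jumps that never occur also
    contribute only 0, the value of [fine] at [+oo]. *)
Definition jump_instants T T' (w : Omega) : set R :=
  \bigcup_n [set 0; fine (T n w); fine (T' n w)].

Lemma countable_jump_instants T T' w : countable (jump_instants T T' w).
Proof.
apply: bigcup_countable => // n _; apply: finite_set_countable.
by rewrite !finite_setU.
Qed.

End jump_instants.

(** * Almost sure properties of the sampler's paths before explosion *)

Section tempered_bps_paths.
Context {R : realType} {d : nat} {dO : measure_display}
  {Omega : measurableType dO}.
Variables (U sigma : 'rV[R]_d -> R) (lam_r : R) (P : probability Omega R)
  (F : R -> set (set Omega)) (X V : R -> Omega -> option 'rV[R]_d)
  (Tb Tr : nat -> Omega -> \bar R) (Vr : nat -> Omega -> 'rV[R]_d).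
Hypothesis lam_gt0 : 0 < lam_r.
Hypothesis hXV : tempered_bps U sigma lam_r P F X V Tb Tr Vr.

Local Notation tau := (explosion_time X V Tb).
Local Notation v w := (fun s => fin_part V s w).

Let jump_Tb w : jump_times (Tb ^~ w).
Proof. exact: point_process_jump_times w (tbps_bounce_times hXV). Qed.

Let jump_Tr w : jump_times (Tr ^~ w).
Proof.
exact: point_process_jump_times w
  (poisson_point_process (tbps_refresh_times hXV)).
Qed.

Definition regular_path (w : Omega) : Prop :=
  [/\ (tau w < +oo)%E ->
        ereal_sup [set total_size X V Tb t w | t in
          [set t : R | 0 <= t /\ (t%:E < tau w)%E]] = +oo%E,
      forall t : R, 0 <= t -> (t%:E < tau w)%E ->
        fin_part X t w = fin_part X 0 w +
          \row_i (\int[lebesgue_measure]_(s in `[0, t]) fin_part V s w 0 i),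
      forall t : R, 0 <= t -> (t%:E < tau w)%E ->
        fin_part V t w = fin_part V 0 w
          + \sum_(n \in [set n | (Tb n w <= t%:E)%E])
              (let s := fine (Tb n w) in let v := left_lim V s w in
               bounce (gradH U sigma (fin_part X s w) v) v - v)
          + \sum_(n \in [set n | (Tr n w <= t%:E)%E])
              (Vr n w - left_lim V (fine (Tr n w)) w) &
      forall t : R, 0 <= t -> exists n, (t%:E < Tr n w)%E].

Lemma ae_regular_path : {ae P, forall w, regular_path w}.
Proof.
near=> w; split; near: w.
- exact: tbps_explosion hXV.
- exact: tbps_position hXV.
- exact: tbps_velocity hXV.
- exact: poisson_process_locally_finite (tbps_filtration hXV) lam_gt0
    (tbps_refresh_times hXV).
Unshelve. all: by end_near. Qed.

(** [tau] is the infimum of the times of infinite total size, and the three terms of that size are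
    nonnegative, so each is finite before [tau]. *)
Lemma finite_before_explosion (t : R) w : 0 <= t -> (t%:E < tau w)%E ->
  [/\ X t w = Some (fin_part X t w), V t w = Some (fin_part V t w) &
      exists n, (t%:E < Tb n w)%E].
Proof.
move=> t0 ttau.
have size_fin : total_size X V Tb t w != +oo%E.
  apply/eqP => size_oo; move: ttau; rewrite ltNge => /negP; apply.
  by apply: ereal_inf_lbound; exists t.
have N0 := counting_at_ge0 Tb t w.
have ext0 (x : option 'rV[R]_d) : (0 <= ext_norm x)%E.
  by case: x => [x|] /=; rewrite ?lee_fin ?sqrtr_ge0// leey.
have ooD (a : \bar R) : (0 <= a)%E -> (+oo + a = +oo)%E by case: a.
have Doo (a : \bar R) : (0 <= a)%E -> (a + +oo = +oo)%E by case: a.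
move: size_fin (ext0 (X t w)) (ext0 (V t w)); rewrite /total_size /fin_part.
case: (X t w) => [x|] /= + x0 u0; last by rewrite !ooD.
case: (V t w) u0 => [u|] /= u0; last by rewrite Doo// ooD.
move=> size_fin; split=> //; apply: contrapT => /forallNP Tt.
move: size_fin; rewrite (counting_at_pinfty (T := Tb)) ?Doo ?adde_ge0//.
by move=> n; rewrite leNgt; apply/negP/Tt.
Qed.

Section regular.
Variable w : Omega.
Hypothesis reg : regular_path w.

Let velocity := let: And4 _ _ h _ := reg in h.
Let Tr_locfin := let: And4 _ _ _ h := reg in h.
Let Tb_locfin (t : R) (t0 : 0 <= t) (ttau : (t%:E < tau w)%E) :=
  let: And3 _ _ h := finite_before_explosion t0 ttau in h.

Let velocity_bound (t1 : R) : 0 <= t1 -> exists2 B, 0 <= B &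
  forall t, 0 <= t <= t1 -> (t%:E < tau w)%E -> `|fin_part V t w| <= B.
Proof.
move=> t10.
exact: (velocity_bounded (g := fun s l => gradH U sigma (fin_part X s w) l)
  (jump_Tb w) (jump_Tr w) velocity Tb_locfin Tr_locfin t10).
Qed.

Let position_bound (t K : R) : 0 <= t -> (t%:E < tau w)%E -> 0 <= K ->
  (forall s, 0 <= s <= t -> ~ jump_instants Tb Tr w s ->
    `|fin_part V s w| <= K) ->
  `|fin_part X t w| <= `|fin_part X 0 w| + K * t.
Proof.
move=> t0 ttau K0 vK; have [_ -> // _ _] := reg.
apply: le_trans (ler_normD _ _) _; rewrite lerD2l.
apply: norm_le_coord => [|i]; first by rewrite mulr_ge0.
rewrite mxE.
apply: (Rintegral_le_off_countable (countable_jump_instants Tb Tr w)) => //.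
by move=> s st Js; apply: le_trans (coord_le_norm _ _) (vK _ st Js).
Qed.

(** If [tau] were 0, the supremum of the sizes would run over the empty set and be [-oo]. If the
    bounce of index [n] were not before [tau], at most [n] bounces would precede [tau], and with
    bounded position and velocity the supremum would be finite. *)
Lemma bounces_before_explosion : (tau w < +oo)%E ->
  (0 < tau w)%E /\ forall n, (Tb n w < tau w)%E.
Proof.
move=> tau_oo; have [/(_ tau_oo) sup_oo _ _ _] := reg.
have tau_ge0 : (0 <= tau w)%E.
  by apply: le_ereal_inf_tmp => _ [t [t0 _] <-]; rewrite lee_fin.
have tauE : tau w = (fine (tau w))%:E by rewrite fineK// ge0_fin_numE.
set t1 := fine (tau w) in tauE.
have t10 : 0 <= t1 by rewrite -lee_fin -tauE.
have lt_t1 t : (t%:E < tau w)%E -> t <= t1 by rewrite tauE lte_fin => /ltW.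
split.
  rewrite lt_neqAle tau_ge0 andbT; apply/eqP => tau0; move: sup_oo.
  rewrite (_ : [set _ | _ in _] = set0) ?ereal_sup0//.
  apply/seteqP; split=> // y [t [t0]].
  by rewrite -tau0 lte_fin ltNge t0.
move=> n; rewrite ltNge; apply/negP => tauT.
have [B B0 vB] := velocity_bound t10.
pose xB := `|fin_part X 0 w| + B * t1.
pose q (K : R) := 1 + d%:R * K ^+ 2.
suff : (ereal_sup [set total_size X V Tb t w | t in
          [set t : R | (0 <= t)%R /\ (t%:E < tau w)%E]] <=
        (q xB + q B)%:E + n%:R%:E)%E by rewrite sup_oo.
apply: ge_ereal_sup => _ [t [t0 ttau] <-].
have [Xt Vt _] := finite_before_explosion t0 ttau.
rewrite /total_size Xt Vt /=; apply: leeD.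
  rewrite -EFinD lee_fin; apply: lerD; apply: enorm_le_norm.
    apply: le_trans (position_bound t0 ttau B0 _) _.
      move=> s /andP[s0 st] _; apply: vB.
        by rewrite s0 (le_trans st)// lt_t1.
      by apply: le_lt_trans ttau; rewrite lee_fin.
    by rewrite lerD2l ler_wpM2l// lt_t1.
  by apply: vB => //; rewrite t0 lt_t1.
exact: counting_at_le (jump_Tb w) (lt_le_trans ttau tauT).
Qed.

(** A single integer for all three bounds lets countably many localisations cover every explosive
    path. *)
Lemma bounded_before_explosion : (tau w < +oo)%E -> exists m : nat,
  [/\ (tau w <= m%:R%:E)%E, `|fin_part X 0 w| <= m%:R &
      forall t : R, 0 <= t -> (t%:E < tau w)%E -> `|fin_part V t w| <= m%:R].
Proof.
move=> tau_oo; have [tau0 _] := bounces_before_explosion tau_oo.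
have tauE : tau w = (fine (tau w))%:E by rewrite fineK// ge0_fin_numE// ltW.
have t10 : 0 <= fine (tau w) by rewrite fine_ge0// ltW.
have [B B0 vB] := velocity_bound t10.
pose M := fine (tau w) + `|fin_part X 0 w| + B.
have Mm : M <= (Num.truncn M).+1%:R by rewrite ltW// truncnS_gt.
have X0 := normr_ge0 (fin_part X 0 w).
exists (Num.truncn M).+1; split.
- rewrite tauE lee_fin; apply: le_trans Mm.
  by rewrite /M -addrA lerDl addr_ge0.
- by apply: le_trans Mm; rewrite /M; lra.
- move=> t t0 ttau; apply: (@le_trans _ _ M).
    apply: le_trans (vB t _ ttau) _; last by rewrite /M; lra.
    by rewrite t0 -lee_fin -tauE ltW.
  exact: Mm.
Qed.

(** Countably many conditions on the past control the state. Off the jump instants the velocity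
    equals its value at a slightly earlier rational time; the position follows by integration, which
    ignores these countably many instants. *)
Lemma state_bound_off_jumps (K t : R) : 0 <= t -> (t%:E < tau w)%E ->
  ~ jump_instants Tb Tr w t -> `|fin_part X 0 w| <= K ->
  (forall q : rat, 0 <= (ratr q : R) < t -> `|fin_part V (ratr q) w| <= K) ->
  `|fin_part V t w| <= K /\ `|fin_part X t w| <= K + K * t.
Proof.
move=> t0 ttau Jt X0K qK.
have vK s : 0 <= s <= t -> ~ jump_instants Tb Tr w s -> `|fin_part V s w| <= K.
  move=> /andP[s0 st] Js.
  have stau : (s%:E < tau w)%E by apply: le_lt_trans ttau; rewrite lee_fin.
  have {}s0 : 0 < s.
    rewrite lt_neqAle s0 andbT; apply/eqP => s0'.
    by apply: Js; exists 0%N => //; left; left.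
  have [||u0 /andP[u00 u0s] vs] :=
    velocity_nonjump (g := fun s l => gradH U sigma (fin_part X s w) l)
      (jump_Tb w) (jump_Tr w) velocity Tb_locfin Tr_locfin s0 stau.
  - move=> n; apply/eqP => Ts; apply: Js; exists n => //.
    by left; right; rewrite Ts.
  - by move=> n; apply/eqP => Ts; apply: Js; exists n => //; right; rewrite Ts.
  have [q] := rat_in_itvoo u0s; rewrite inE /= => u0qs.
  have -> := vs _ u0qs; apply: qK; move: u0qs => /andP[u0q qs].
  by apply/andP; split; [exact/ltW/(le_lt_trans u00)|exact: lt_le_trans st].
have K0 : 0 <= K by exact: le_trans X0K.
split; first by apply: vK => //; rewrite t0 lexx.
by apply: le_trans (position_bound t0 ttau K0 vK) _; rewrite lerD2r.
Qed.

End regular.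
End tempered_bps_paths.

(** * A predictable localising set *)

Section localisation.
Context {R : realType} {dO : measure_display} {Omega : measurableType dO}.
Variables (F : R -> set (set Omega)) (A0 : set Omega) (A : rat -> set Omega)
  (t : R).

Definition localised : set (R * Omega) :=
  [set p | [/\ 0 <= p.1 <= t, A0 p.2 &
    forall q : rat, 0 <= (ratr q : R) < p.1 -> A q p.2]].

Hypothesis hF : filtration F.
Hypothesis t_ge0 : 0 <= t.
Hypothesis F_A0 : F 0 A0.
Hypothesis F_A : forall q, 0 <= (ratr q : R) -> F (ratr q) (A q).

Let predictable_after (s : R) B : 0 <= s -> F s B ->
  predictable_sigma F ([set u | s < u] `*` B).
Proof.
move=> s0 FB.
have -> : [set u | s < u] `*` B = \bigcup_n (`]s, s + n%:R]%classic `*` B).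
  apply/seteqP; split=> [[u w] /= [su Bw]|[u w] [n _] [/= + Bw]].
    exists (Num.truncn (u - s)).+1 => //; split=> //=.
    by rewrite in_itv/= su/= -lerBlDl ltW// truncnS_gt.
  by rewrite in_itv/= => /andP[].
apply: sigma_algebra_bigcup => n; apply: sub_sigma_algebra; right.
by exists s, (s + n%:R), B; split=> //; rewrite lerDl.
Qed.

(** A failure of [A q] excludes exactly the times after [q]. The set is thus a predictable rectangle
    minus a countable union of sets []q, +oo[] times the complement of [A q]. *)
Let predictable_localised_set : predictable_sigma F localised.
Proof.
pose C (q : rat) : set (R * Omega) :=
  if 0 <= (ratr q : R) then [set u | ratr q < u] `*` ~` A q else set0.
have -> : localised =
    (([set 0] `*` A0) `|` (`]0, t]%classic `*` A0)) `&` ~` \bigcup_q C q.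
  apply/seteqP; split=> [[s w] /= [/andP[s0 st] A0w Aw]|[s w] /=].
    split.
      have [->|s_neq0] := eqVneq s 0; first by left.
      by right; split=> //=; rewrite in_itv/= lt_neqAle eq_sym s_neq0 s0.
    move=> [q _]; rewrite /C; case: ifPn => // q0 [/= qs]; apply.
    by apply: Aw; rewrite q0.
  move=> [st NC].
  have [s0t A0w] : 0 <= s <= t /\ A0 w.
    case: st => -[/= + A0w]; first by move=> ->; rewrite lexx.
    by rewrite in_itv/= => /andP[/ltW -> ->].
  split=> // q /andP[q0 qs]; apply: contrapT => NA; apply: NC.
  by exists q => //; rewrite /C q0.
pose G := [set B | (exists A, F 0 A /\ B = [set 0] `*` A) \/
  (exists (s t : R) A, [/\ 0 <= s, s <= t, F s A & B = `]s, t]%classic `*` A])].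
apply: (@measurableI _ (g_sigma_algebraType G)).
  apply: (@measurableU _ (g_sigma_algebraType G)); apply: sub_sigma_algebra.
    by left; exists A0.
  by right; exists 0, t, A0.
apply: (@measurableC _ (g_sigma_algebraType G)).
apply: (@bigcupT_measurable_rat _ (g_sigma_algebraType G)) => q; rewrite /C.
case: ifPn => [q0|_]; last exact: sigma_algebra0.
apply: predictable_after => //; have [_ FC _] := filtration_sigma hF q0.
by rewrite -setTD; apply/FC/F_A.
Qed.

Lemma predictable_localised : predictable F (fun s w => \1_localised (s, w)).
Proof.
move=> B _; have -> : [set p : R * Omega | B (\1_localised (p.1, p.2))] =
    \1_localised @^-1` B by apply/seteqP; split=> -[].
rewrite preimage_indic; case: ifPn => _; case: ifPn => _ //.
- exact: (@measurableT _ (g_sigma_algebraType _)).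
- exact: sigma_algebraC.
- exact: sigma_algebra0.
Qed.

End localisation.

(** * The compensator bound and nonexplosion *)

Section tempered_bps_nonexplosion.
Context {R : realType} {d : nat} {dO : measure_display}
  {Omega : measurableType dO}.
Variables (U sigma : 'rV[R]_d -> R) (lam_r : R) (P : probability Omega R)
  (F : R -> set (set Omega)) (X V : R -> Omega -> option 'rV[R]_d)
  (Tb Tr : nat -> Omega -> \bar R) (Vr : nat -> Omega -> 'rV[R]_d).
Hypothesis smooth_U : smooth U.
Hypothesis smooth_sigma : smooth sigma.
Hypothesis sigma_ge1 : forall x, 1 <= sigma x.
Hypothesis lam_gt0 : 0 < lam_r.
Hypothesis hXV : tempered_bps U sigma lam_r P F X V Tb Tr Vr.

Local Notation tau := (explosion_time X V Tb).

(** Shaped like the events of [adapted]; a state at infinity is excluded. *)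
Let bounded_at (Y : R -> Omega -> option 'rV[R]_d) (K s : R) : set Omega :=
  [set w | exists2 y, [set y | `|y| <= K] y & Y s w = Some y].

Let bounded_at_fin_part Y K s w : bounded_at Y K s w ->
  `|fin_part Y s w| <= K.
Proof. by move=> [y yK]; rewrite /fin_part => ->. Qed.

Let adapted_bounded_at Y K s : adapted F Y -> 0 <= s -> F s (bounded_at Y K s).
Proof.
move=> aY s0; apply: aY => //; rewrite -[X in borel X]setCK.
apply: sigma_algebraC; apply: sub_sigma_algebra; apply: closed_openC.
apply: (@closed_comp _ _ (fun x : 'rV[R]_d => `|x|) [set y | y <= K]).
  by move=> x _; exact: norm_continuous.
exact: closed_le.
Qed.

Let loc (m : nat) : set (R * Omega) :=
  localised (bounded_at X m%:R 0) (fun q => bounded_at V m%:R (ratr q)) m%:R.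

Let bounces (m : nat) w : \bar R :=
  (\sum_(0 <= n <oo)
    (if Tb n w < tau w then (\1_(loc m) (fine (Tb n w), w))%:E else 0))%E.

(** The compensator formula turns this mean into that of the bounce rate integrated over [loc m], a
    set of times within [[0, m]] on which the rate is at most a constant [M] off the jump
    instants. *)
Let bounces_integral_fin (m : nat) : (\int[P]_w bounces m w < +oo)%E.
Proof.
have m0 : 0 <= m%:R :> R by [].
have predC : predictable F (fun s w => \1_(loc m) (s, w)).
  apply: predictable_localised => //; first exact: tbps_filtration hXV.
    exact: adapted_bounded_at (tbps_adaptedX hXV) (lexx 0).
  by move=> q q0; exact: adapted_bounded_at (tbps_adaptedV hXV) q0.
have C0 s w : 0 <= \1_(loc m) (s, w) :> R by rewrite indicE.
rewrite /bounces (tbps_bounce_intensity hXV predC C0).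
(* Starting within [m] and moving at velocity at most [m] for a time at most [m], the position stays
   within m + m^2. *)
pose K : R := m%:R + m%:R * m%:R.
have mK : m%:R <= K by rewrite /K lerDl mulr_ge0.
have [M M0 rateM] :=
  bounce_rate_bounded smooth_U smooth_sigma sigma_ge1 (le_trans m0 mK).
have rate0 x v : 0 <= bounce_rate U sigma x v.
  by rewrite /bounce_rate le_max lexx.
have [N [mN N0 regN]] := ae_regular_path lam_gt0 hXV.
apply: (@le_lt_trans _ _ (\int[P]_w (M * m%:R)%:E)%E).
  apply: (ge0_integral_le_off_null mN N0).
  - by move=> w _; apply: integral_ge0 => s _; rewrite lee_fin mulr_ge0.
  - exact: measurable_cst.
  - by move=> w; rewrite lee_fin mulr_ge0.
  move=> w _ Nw; have reg : regular_path U sigma X V Tb Tr Vr w.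
    by apply: contrapT => nreg; exact/Nw/regN.
  apply: (ge0_integral_le_off_countable (countable_jump_instants Tb Tr w)) => //.
    by move=> s _; rewrite lee_fin mulr_ge0.
  move=> s [s0 stau] Js; rewrite lee_fin indicE.
  case: (boolP ((s, w) \in loc m)) => [/set_mem[/= st Xw Vw]|_]; last first.
    by rewrite mul0r; case: ifP.
  rewrite mul1r in_itv/= st; apply: rateM.
    have [_ /le_trans] := state_bound_off_jumps hXV reg s0 stau Js
      (bounded_at_fin_part Xw) (fun q qs => bounded_at_fin_part (Vw q qs)).
    by apply; rewrite lerD2l ler_wpM2l//; move/andP: st => [].
  have [/le_trans + _] := state_bound_off_jumps hXV reg s0 stau Js
      (bounded_at_fin_part Xw) (fun q qs => bounded_at_fin_part (Vw q qs)).
  exact.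
apply: (@le_lt_trans _ _ ((M * m%:R)%:E * P setT)%E).
  by rewrite integral_cst.
by rewrite probability_setT mule1 ltry.
Qed.

(** Phrased through bounce times and rational times instead of [explosion_time], so that it is
    measurable: the velocity is bounded at each rational time preceding some bounce. *)
Let accumulation (m : nat) : set Omega :=
  bounded_at X m%:R 0 `&`
  \bigcap_n ([set w | (Tb n w <= m%:R%:E)%E] `&`
    \bigcap_(q in [set q : rat | 0 <= (ratr q : R)])
      ([set w | (Tb n w <= (ratr q)%:E)%E] `|` bounded_at V m%:R (ratr q))).

Let measurable_accumulation m : measurable (accumulation m).
Proof.
have hF := tbps_filtration hXV.
have mT n (s : R) : 0 <= s -> measurable [set w | (Tb n w <= s%:E)%E].
  move=> s0; apply: (filtration_sub hF s0).
  exact: point_process_adapted (tbps_bounce_times hXV) n s s0.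
apply: measurableI.
  apply: (filtration_sub hF (lexx 0)).
  exact: adapted_bounded_at (tbps_adaptedX hXV) (lexx 0).
apply: bigcapT_measurable => n; apply: measurableI; first exact: mT.
rewrite -[X in measurable X]setCK setC_bigcap; apply: measurableC.
rewrite bigcup_mkcond; apply: bigcupT_measurable_rat => q.
case: ifPn => [/set_mem /= q0|_ //]; apply/measurableC/measurableU.
  exact: mT.
apply: (filtration_sub hF q0).
exact: adapted_bounded_at (tbps_adaptedV hXV) q0.
Qed.

(* On [accumulation m] infinitely many bounces are counted by the predictable
   process [\1_(loc m)], whose compensator has finite mean. *)
Let accumulation_negligible m : P.-negligible (accumulation m).
Proof.
have [N [mN N0 regN]] := ae_regular_path lam_gt0 hXV.
have mD : measurable (accumulation m `\` N).
  exact: measurableD (measurable_accumulation m) mN.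
suff D0 : P (accumulation m `\` N) = 0%E.
  apply: (negligibleS (A := (accumulation m `\` N) `|` N)).
    by move=> w aw; have [Nw|Nw] := pselect (N w); [right|left].
  by apply: negligibleU; [exists (accumulation m `\` N)|exists N]; split.
apply: contrapT => /eqP D_neq0.
have := bounces_integral_fin m; rewrite ltNge => /negP; apply.
(* If this event had positive probability, [+oo] on it would be a measurable minorant of [bounces m]
   with infinite integral. *)
rewrite -[leLHS](_ : \int[P]_(w in accumulation m `\` N) +oo = +oo)%E; last first.
  rewrite integral_cst// gt0_mulye// lt_neqAle eq_sym D_neq0.
  exact: measure_ge0.
have bounces0 w : (0 <= bounces m w)%E.
  by apply: nneseries_ge0 => n _ _; case: ifP => // _; rewrite lee_fin indicE.
apply: ge0_subset_le_integral => // w; rewrite patch_setT patchE.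
case: ifPn => [/set_mem[[Xw Tw] Nw]|//].
have reg : regular_path U sigma X V Tb Tr Vr w.
  by apply: contrapT => nreg; exact/Nw/regN.
have Tm n : (Tb n w <= m%:R%:E)%E by have [] := Tw n I.
(* Infinitely many bounces by time [m] force explosion by [m]; then all of them precede [tau], and
   every term of the series equals 1. *)
have tau_oo : (tau w < +oo)%E.
  apply: (@le_lt_trans _ _ m%:R%:E); last exact: ltry.
  rewrite leNgt; apply/negP => mtau.
  have [_ _ [n]] := finite_before_explosion (ler0n R m) mtau.
  by rewrite ltNge Tm.
have [_ Ttau] := bounces_before_explosion hXV reg tau_oo.
rewrite /bounces nneseries_ge1_pinfty// => n; rewrite Ttau lee_fin indicE.
have jT := point_process_jump_times w (tbps_bounce_times hXV).
have Tf := jump_times_fineK jT (le_lt_trans (Tm n) (ltry _)).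
rewrite mem_set//; split=> //=.
  by rewrite -!lee_fin -Tf (ltW (jump_times_gt0 n jT)) Tm.
move=> q /andP[q0 qT]; have [_ /(_ q q0)] := Tw n I; case=> //=.
by rewrite leNgt => /negP; case; rewrite Tf lte_fin.
Qed.

(** A regular explosive path has all its bounces before [tau], so the common bound [m] places it in
    [accumulation m]. *)
Lemma tempered_bps_nonexplosion : P.-negligible [set w | (tau w < +oo)%E].
Proof.
have [N [mN N0 regN]] := ae_regular_path lam_gt0 hXV.
apply: (negligibleS (A := N `|` \bigcup_m accumulation m)); last first.
  apply: negligibleU; first by exists N; split.
  exact: negligible_bigcup accumulation_negligible.
move=> w /= tau_oo; have [Nw|Nw] := pselect (N w); [by left|right].
have reg : regular_path U sigma X V Tb Tr Vr w.
  by apply: contrapT => nreg; exact/Nw/regN.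
have [tau0 Ttau] := bounces_before_explosion hXV reg tau_oo.
have [m [taum Xm Vm]] := bounded_before_explosion hXV reg tau_oo.
exists m => //; split.
  have [Xw _ _] := finite_before_explosion (lexx 0) tau0.
  by exists (fin_part X 0 w).
move=> n _; split; first exact: le_trans (ltW (Ttau n)) taum.
move=> q /= q0; have [qT|] := leP (Tb n w) (ratr q)%:E; [by left|right].
have qtau : ((ratr q : R)%:E < tau w)%E by apply: lt_trans (Ttau n).
have [_ Vw _] := finite_before_explosion q0 qtau.
by exists (fin_part V (ratr q) w) => //=; exact: Vm.
Qed.

End tempered_bps_nonexplosion.

Theorem lemma3p3 (R : realType) (d : nat) (hd : (0 < d)%N)
  (U sigma : 'rV[R]_d -> R)
  (hU : smooth U)
  (hZ : (0 < partition_function U < +oo)%E)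
  (hsigma_smooth : smooth sigma)
  (hsigma_lip : lipschitz_fun sigma)
  (hsigma_ge1 : forall x, 1 <= sigma x)
  (lam_r : R) (hlam : 0 < lam_r)
  (dO : measure_display) (Omega : measurableType dO) (P : probability Omega R)
  (F : R -> set (set Omega))
  (X V : R -> Omega -> option 'rV[R]_d)
  (Tb Tr : nat -> Omega -> \bar R) (Vr : nat -> Omega -> 'rV[R]_d)
  (hXV : tempered_bps U sigma lam_r P F X V Tb Tr Vr) :
  P.-negligible [set w | (explosion_time X V Tb w < +oo)%E].
Proof.
exact: tempered_bps_nonexplosion hU hsigma_smooth hsigma_ge1 hlam hXV.
Qed.
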